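(* Let $\sigma$ be an irreducible Pisot substitution over the alphabet $\mathcal A$ and fix $a\in\mathcal A$. Let $\mathcal R_\sigma(a)$ be the associated Dumont-Thomas subtile, $\mathcal T_\sigma(a)$ the associated $E_1^*$-subtile, and $\varOmega_a$ the associated dual prototile. Then $$\mathcal R_\sigma(a)=\varOmega_a=G\,\mathcal T_\sigma(a).$$
   Context: Substitutions. $\mathcal A=\{1,\dots,n\}$, $\mathcal A^*$ the free monoid of finite words. A substitution is an endomorphism $\sigma$ of $\mathcal A^*$ such that the image of each letter is non-empty and $|\sigma^k(b)|\to\infty$ for at least one letter $b$. $\mathbf P(w)=(|w|_1,\dots,|w|_n)^t$; $M_\sigma$ has entries $(M_\sigma)_{a,b}=|\sigma(b)|_a$. $\sigma$ is an irreducible Pisot substitution if $M_\sigma$ is primitive with characteristic polynomial irreducible over $\mathbb Q$ and its dominant eigenvalue $\alpha$ is a Pisot number (algebraic integer $>1$ all of whose other conjugates have modulus $<1$; not necessarily a unit). The prefix automaton has vertex set $\mathcal A$ and an edge $b\xrightarrow{p}a$ whenever $\sigma(b)=pas$ for some $p,s\in\mathcal A^*$. Number field. $K=\mathbb Q(\alpha)$; $S_\alpha$ is the set of primes (places) of $K$ that are infinite or are finite and divide $(\alpha)$; $K_{\mathfrak p}$ is the completion at $\mathfrak p$; $\mathfrak p_1$ is the infinite prime with $|\alpha|_{\mathfrak p_1}=\alpha$; $K_\sigma=\prod_{\mathfrak p\in S_\alpha\setminus\{\mathfrak p_1\}}K_{\mathfrak p}$; $\Phi':K\to K_\sigma$ is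 the diagonal embedding; $K$ acts on $K_\sigma$ by coordinatewise multiplication. $\mathbf v_\alpha=(v_1,\dots,v_n)$ is a left eigenvector of $M_\sigma$ for $\alpha$ with positive entries in $\mathbb Q(\alpha)$, and $\delta(w)=\langle\mathbf P(w),\mathbf v_\alpha\rangle$ for $w\in\mathcal A^*$. Dumont-Thomas subtile. $\mathbb Z_{\sigma,a}^{(k)}\subset\mathbb R$ is the set of sums $\sum_{i=0}^{k-1}\delta(p_i)\alpha^i$ over all walks $a_k\xrightarrow{p_{k-1}}\cdots\xrightarrow{p_1}a_1\xrightarrow{p_0}a$ of length $k$ in the prefix automaton ending at $a$. $\mathbb Z_{\sigma,a}$ is the topological (Kuratowski) limit of $\mathbb Z_{\sigma,a}^{(k)}$ as $k\to\infty$ (it exists). $\mathcal R_\sigma(a)=\overline{\Phi'(\mathbb Z_{\sigma,a})}\subset K_\sigma$. Dual prototile. $(\varOmega_a)_{a\in\mathcal A}$ is the unique family of non-empty compact subsets of $K_\sigma$ with $\varOmega_a=\bigcup_{b\xrightarrow{p}a}\big(\alpha\varOmega_b+\Phi'(\delta(p))\big)$ for all $a\in\mathcal A$, the union running over all edges of the prefix automaton ending at $a$. $E_1^*$-subtile. $Z=\bigcup_{k\ge0}M_\sigma^{-k}\mathbb Z^n$, $Z_{\rm ext}=Z\times\prod_{\mathfrak p\mid(\alpha)}K_{\mathfrak p}$, $\Psi:Z\to Z_{\rm ext}$, $\Psi(\mathbf x)=(\mathbf x,\langle\mathbf x,\mathbf v_\alpha\rangle,\dots,\langle\mathbf x,\mathbf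 v_\alpha\rangle)$; $M_\sigma$ acts on $Z_{\rm ext}$ as $M_\sigma$ on $Z$ and as multiplication by $\alpha$ on each $K_{\mathfrak p}$. $E_1^*$ acts on subsets of $\Psi(Z)\times\mathcal A$ (elements written $[\mathbf z,a]^*$) by $E_1^*[\mathbf z,a]^*=\bigcup_{b\xrightarrow{p}a}\{[M_\sigma^{-1}(\mathbf z+\Psi(\mathbf P(p))),b]^*\}$, extended by unions. $\mathbb H\subset\mathbb R^n$ is the hyperplane orthogonal to $\mathbf v_\alpha$, $\mathbb H_{\rm ext}=\mathbb H\times\prod_{\mathfrak p\mid(\alpha)}K_{\mathfrak p}$, and $\pi_{\mathbf u}:\mathbb R^n\to\mathbb H$ is the projection along the right eigenvector $\mathbf u_\alpha$ of $M_\sigma$ for $\alpha$, normalized by $\langle\mathbf u_\alpha,\mathbf v_\alpha\rangle=1$. Then $\mathcal T_\sigma(a)=\lim_{k\to\infty}(\pi_{\mathbf u}\times\mathrm{id})\big(M_\sigma^k\cdot(E_1^* )^k[\mathbf 0,a]^*\big)\subset\mathbb H_{\rm ext}$, limit in the Hausdorff metric (it exists; the letter component of the elements of $(E_1^* )^k[\mathbf 0,a]^*$ is forgotten). The map $G:\mathbb H_{\rm ext}\to K_\sigma$ is $G(\mathbf x,\mathbf y)=\Big(\big(\sum_{i=1}^n x_i\tau_{\mathfrak p}(v_i)\big)_{\mathfrak p\mid\infty,\,\mathfrak p\ne\mathfrak p_1},\ \mathbf y\Big)$, where $\tau_{\mathfrak p}:K\to K_{\mathfrak p}$ is the embedding corresponding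 to $\mathfrak p$. *)

(* Defs.v *)
From HB Require Import structures.
From mathcomp Require Export all_boot all_order all_algebra all_field.
From mathcomp.real_closed Require Export complex.
From mathcomp Require Export all_classical all_reals all_analysis.
Export numFieldNormedType.Exports.

Set Implicit Arguments.
Unset Strict Implicit.
Unset Printing Implicit Defensive.

Import Order.TTheory GRing.Theory Num.Theory.
Local Open Scope classical_set_scope.
Local Open Scope ring_scope.

Section Substitutions.
Variables (n : nat) (sigma : 'I_n -> seq 'I_n).

(* An endomorphism of the free monoid is given by its values on letters. *)
Definition subst_word (w : seq 'I_n) : seq 'I_n := flatten (map sigma w).

Definition is_substitution : Prop :=
  (forall b, sigma b != [::]) /\
  exists b, (fun k : nat => size (iter k subst_word [:: b])) @ \oo --> \oo.

Definition incidence (A : nzRingType) : 'M[A]_n :=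
  \matrix_(a < n, b < n) (count_mem a (sigma b))%:R.

Definition parikh (A : nzRingType) (w : seq 'I_n) : 'cV[A]_n :=
  \col_(a < n) (count_mem a w)%:R.

(* The edge b --p--> a. *)
Definition prefix_edge (b : 'I_n) (p : seq 'I_n) (a : 'I_n) : Prop :=
  exists s, sigma b = p ++ a :: s.

(* c k --p (k-1)--> ... --p 1--> c 1 --p 0--> c 0 = a;
   values of c and p beyond these indices are irrelevant. *)
Definition prefix_walk (k : nat) (c : nat -> 'I_n) (p : nat -> seq 'I_n)
    (a : 'I_n) : Prop :=
  c 0%N = a /\ forall i, (i < k)%N -> prefix_edge (c i.+1) (p i) (c i).

Definition primitive_incidence : Prop :=
  exists2 k : nat, (0 < k)%N &
    forall i j, 0 < (incidence int ^+ k) i j.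

End Substitutions.

Section PisotNumbers.
Variable R : realType.

(* The conjugates of x are the complex roots of its minimal polynomial over
   the rationals, i.e. of any irreducible rational polynomial vanishing at x. *)
Definition is_conjugate (x : R) (z : R[i]) : Prop :=
  exists p : {poly rat},
    [/\ irreducible_poly p, root (map_poly ratr p) x
      & root (map_poly ratr p) z].

Definition is_pisot (x : R) : Prop :=
  [/\ integralOver (intr : int -> R) x, 1 < x
    & forall z, is_conjugate x z -> z != x%:C%C -> Normc.normc z < 1].

Definition is_dominant_eigenvalue n (A : forall F : nzRingType, 'M[F]_n)
    (x : R) : Prop :=
  eigenvalue (A R[i]) x%:C%C /\
  forall z : R[i], eigenvalue (A R[i]) z -> z != x%:C%C -> Normc.normc z < x.

Definition is_irreducible_pisot n (sigma : 'I_n -> seq 'I_n) (x : R) : Prop :=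
  [/\ primitive_incidence sigma,
      irreducible_poly (char_poly (incidence sigma rat)),
      is_dominant_eigenvalue (incidence sigma) x
    & is_pisot x].

End PisotNumbers.

Section AbsoluteValues.
Variables (R : realType) (K : fieldType).

Record is_absval (w : K -> R) : Prop := IsAbsval {
  absval_ge0 : forall x, 0 <= w x;
  absval_eq0 : forall x, w x = 0 <-> x = 0;
  absvalM : forall x y, w (x * y) = w x * w y;
  absvalD : forall x y, w (x + y) <= w x + w y }.

End AbsoluteValues.

(* Every place of a number field contains exactly one of the absolute values
   singled out by [is_infinite_place] and [is_finite_place], which we use to
   represent it.  For infinite places these are the x |-> |phi x| for complex
   embeddings phi (two embeddings give the same one iff they are equal or
   conjugate).  For finite places they are the ultrametric absolute values
   extending a p-adic one on the rationals, normalized by |p| = 1/p. *)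
Section Places.
Variables (R : realType) (K : fieldType).

Definition is_infinite_place (w : K -> R) : Prop :=
  exists phi : {rmorphism K -> R[i]}, w = fun x => Normc.normc (phi x).

Definition is_finite_place (w : K -> R) : Prop :=
  [/\ is_absval w,
      forall x y, w (x + y) <= Num.max (w x) (w y)
    & exists2 p : nat, prime p & w p%:R = p%:R^-1].

(* The infinite places other than the one of the real embedding iota. *)
Definition other_infinite_place (iota : {rmorphism K -> R}) :=
  {w : K -> R | is_infinite_place w /\ w <> fun x => `|iota x|}.

(* For an algebraic integer alpha, the finite prime of w divides the ideal
   (alpha) iff w alpha < 1. *)
Definition finite_place_dividing (alpha : K) :=
  {w : K -> R | is_finite_place w /\ w alpha < 1}.

End Places.
Arguments finite_place_dividing R {K} alpha.

Section Completions.
Variables (R : realType) (K : fieldType) (w : K -> R).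

Record valued_ext := ValuedExt {
  vfield : fieldType;
  vabs : vfield -> R;
  vabs_absval : is_absval vabs;
  vemb : {rmorphism K -> vfield};
  vabs_vemb : forall x, vabs (vemb x) = w x }.

Definition vsort (E : valued_ext) : Type := vfield E.

HB.instance Definition _ (E : valued_ext) := GRing.Field.on (vsort E).

Section Metric.
Variable E : valued_ext.
Implicit Types x y z : vsort E.

Definition vdist x y : R := @vabs E (x - y).

Lemma vdistxx x : vdist x x = 0.
Proof. by apply/(absval_eq0 (vabs_absval E)); rewrite subrr. Qed.

Lemma vdist_eq0 x y : vdist x y = 0 -> x = y.
Proof. by move/(absval_eq0 (vabs_absval E))/eqP; rewrite subr_eq0 => /eqP. Qed.

Lemma vabsN (x : vfield E) : vabs (- x) = vabs x.
Proof.
have EA := vabs_absval E.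
apply/eqP; rewrite -(eqrXn2 (n := 2)) ?(absval_ge0 EA)//.
by rewrite !expr2 -!(absvalM EA) mulrNN.
Qed.

Lemma vdist_sym x y : vdist x y = vdist y x.
Proof. by rewrite /vdist -opprB vabsN. Qed.

Lemma vdist_triangle y x z : vdist x z <= vdist x y + vdist y z.
Proof.
have /(_ (x - y) (y - z)) := absvalD (vabs_absval E).
by rewrite addrA subrK.
Qed.

HB.instance Definition _ := @isMetric.Build R (vsort E)
  vdist vdistxx vdist_eq0 vdist_sym vdist_triangle.

End Metric.

(* The completion of K at w is determined up to unique isomorphism by this
   universal description: a complete valued field extending (K, w) in which K
   is dense. *)
Record completion := Completion {
  cext :> valued_ext;
  completion_dense : dense (range (vemb cext : K -> vsort cext));
  completion_complete : forall F : set_system (vsort cext),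
    ProperFilter F -> cauchy F -> exists x : vsort cext, F --> x }.

Definition csort (E : completion) : Type := vsort E.
HB.instance Definition _ (E : completion) := GRing.Field.on (csort E).
HB.instance Definition _ (E : completion) := Metric.on (csort E).

Definition cemb (E : completion) : {rmorphism K -> csort E} := vemb E.
Definition cabs (E : completion) : csort E -> R := @vabs E.

End Completions.
Coercion csort : completion >-> Sortclass.

Section SetLimits.

Definition kuratowski_liminf (X : topologicalType) (A : nat -> set X) : set X :=
  [set x | forall U, nbhs x U -> \forall k \near \oo, A k `&` U !=set0].

Definition kuratowski_limsup (X : topologicalType) (A : nat -> set X) : set X :=
  [set x | forall U, nbhs x U ->
     forall N, exists2 k, (N <= k)%N & A k `&` U !=set0].

Definition is_kuratowski_lim (X : topologicalType) (A : nat -> set X)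
    (L : set X) : Prop :=
  kuratowski_liminf A = L /\ kuratowski_limsup A = L.

(* Convergence for the Hausdorff metric on non-empty compact sets; it depends
   only on the uniform structure, and for a metric d the entourages
   {(x, y) | d x y < e} give the usual epsilon-neighbourhood formulation. *)
Definition hausdorff_cvg (X : uniformType) (A : nat -> set X) (L : set X) :
    Prop :=
  [/\ L !=set0, compact L &
    forall E : set (X * X), entourage E -> \forall k \near \oo,
      (forall x, A k x -> exists2 y, L y & E (x, y)) /\
      (forall y, L y -> exists2 x, A k x & E (x, y))].

End SetLimits.

Section Tiles.
Variables (R : realType) (n : nat) (sigma : 'I_n -> seq 'I_n).
Variables (K : fieldExtType rat) (iota : {rmorphism K -> R}) (alpha : K).
Variables (v : 'rV[K]_n) (u : 'cV[R]_n).
Variable Kinf : forall w : other_infinite_place iota, completion (sval w).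
Variable Kfin : forall w : finite_place_dividing R alpha, completion (sval w).

(* K_sigma, with the infinite places (other than p_1) and the finite places
   grouped separately. *)
Definition Ksigma : uniformType :=
  (prod_topology (fun w => Kinf w : uniformType) *
   prod_topology (fun w => Kfin w : uniformType))%type.

Definition Phi (x : K) : Ksigma :=
  ((fun w => cemb (Kinf w) x), (fun w => cemb (Kfin w) x)).

Definition Kact (x : K) (y : Ksigma) : Ksigma :=
  ((fun w => cemb (Kinf w) x * y.1 w), (fun w => cemb (Kfin w) x * y.2 w)).

Definition Kadd (y z : Ksigma) : Ksigma :=
  ((fun w => y.1 w + z.1 w), (fun w => y.2 w + z.2 w)).

Definition pairQ (x : 'cV[rat]_n) : K := \sum_i x i 0 *: v 0 i.

Definition pairR (x : 'cV[R]_n) : R := \sum_i x i 0 * iota (v 0 i).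

Definition delta (w : seq 'I_n) : K := pairQ (parikh rat w).

Definition DT_integers (a : 'I_n) (k : nat) : set R :=
  [set x | exists c p, prefix_walk sigma k c p a /\
     x = \sum_(i < k) iota (delta (p i)) * iota alpha ^+ i].

(* Here K is seen inside the reals through iota. *)
Definition DT_subtile (Z : set R) : set Ksigma :=
  closure (Phi @` (iota @^-1` Z)).

Definition is_dual_prototile (Omega : 'I_n -> set Ksigma) : Prop :=
  [/\ forall a, Omega a !=set0,
      forall a, compact (Omega a)
    & forall a, Omega a =
        [set y | exists b p, prefix_edge sigma b p a /\
           exists2 x, Omega b x & y = Kadd (Kact alpha x) (Phi (delta p))]].

Definition Zmodule : set 'cV[rat]_n :=
  [set x | exists (k : nat) (y : 'cV[int]_n),
     x = invmx (incidence sigma rat) ^+ k *m map_mx intr y].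

(* Ambient space of Z_ext, which consists of the z with z.1 in Zmodule. *)
Definition Qext : Type :=
  ('cV[rat]_n * prod_topology (fun w => Kfin w : uniformType))%type.

Definition Psi (x : 'cV[rat]_n) : Qext :=
  (x, fun w => cemb (Kfin w) (pairQ x)).

Definition Mext (z : Qext) : Qext :=
  (incidence sigma rat *m z.1, fun w => cemb (Kfin w) alpha * z.2 w).

Definition Mext_inv (z : Qext) : Qext :=
  (invmx (incidence sigma rat) *m z.1,
   fun w => (cemb (Kfin w) alpha)^-1 * z.2 w).

Definition Qadd (z z' : Qext) : Qext :=
  (z.1 + z'.1, fun w => z.2 w + z'.2 w).

(* (z, a) stands for [z, a]^*; the domain consists of the subsets of
   Psi(Zmodule) x A, elements outside it are ignored. *)
Definition E1star (X : set (Qext * 'I_n)) : set (Qext * 'I_n) :=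
  [set y | exists z a, [/\ X (z, a), (Psi @` Zmodule) z
     & exists b p, prefix_edge sigma b p a /\
         y = (Mext_inv (Qadd z (Psi (parikh rat p))), b)]].

(* Ambient space of H_ext. *)
Definition Rext : uniformType :=
  ('cV[R]_n * prod_topology (fun w => Kfin w : uniformType))%type.

Definition Hext : set Rext := [set x | pairR x.1 = 0].

(* The projection onto the hyperplane orthogonal to v along u, given that
   <u, v> = 1. *)
Definition pi_u (x : 'cV[R]_n) : 'cV[R]_n := x - pairR x *: u.

Definition pi_u_ext (z : Qext) : Rext := (pi_u (map_mx ratr z.1), z.2).

Definition E1_approx (a : 'I_n) (k : nat) : set Rext :=
  [set x | exists z b, iter k E1star [set (Psi 0, a)] (z, b) /\
     x = pi_u_ext (iter k Mext z)].

Definition is_E1_subtile (a : 'I_n) (T : set Rext) : Prop :=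
  T `<=` Hext /\ hausdorff_cvg (E1_approx a) T.

(* rho w is the inclusion of the reals in the archimedean field K_w. *)
Definition Gmap (rho : forall w, {rmorphism R -> Kinf w}) (x : Rext) : Ksigma :=
  ((fun w => \sum_i rho w (x.1 i 0) * cemb (Kinf w) (v 0 i)), x.2).

End Tiles.
Arguments DT_subtile {R K iota alpha} Kinf Kfin Z.

(* Main.v *)
(* Expanding the set equation k times, a point of Omega a is Phi x + alpha^k y,
   with x the digit sum of a walk of length k ending at a and y in some Omega b.
   As alpha is contracting in every coordinate of K_sigma, the sets Phi(D_k) of
   these finite sums converge to Omega a.

   Digits are non-negative and alpha > 1, so a sum bounded by B has only empty
   prefixes beyond a height depending on B; hence the real sets D_k are locally
   finite uniformly in k, and a point of Z belongs to infinitely many D_k.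
   Conversely, by primitivity every walk extends to one starting at a letter of
   a cycle of the first-letter map.  Such a walk extends indefinitely by empty
   prefixes, so its sum is in Z, while the extension moves its image under Phi
   by a multiple of alpha^k only.

   By induction, (E_1^* )^k [0, a]^* consists of the Psi x with
   alpha^k <x, v> in D_k, and G sends pi_u (M^k x) to Phi (alpha^k <x, v>), since
   the conjugates of v are orthogonal to u.  Thus G maps the k-th approximation
   of T onto Phi(D_k), and G is uniformly continuous. *)
Require Import Defs.

Set Implicit Arguments.
Unset Strict Implicit.
Unset Printing Implicit Defensive.

Import Order.TTheory GRing.Theory Num.Theory.
Local Open Scope classical_set_scope.
Local Open Scope ring_scope.

(** * Uniformities of products *)

Section ProductEntourages.

(** The product uniformity is generated by pullbacks along the coordinates, so a property of
    entourages that defines a filter can be checked one coordinate at a time. *)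
Lemma prod_topology_entourage_sub (I : Type) (T : I -> uniformType)
    (F : set_system (prod_topology T * prod_topology T)) :
  Filter F ->
  (forall i E, entourage E -> F [set xy | E (xy.1 i, xy.2 i)]) ->
  entourage `<=` F.
Proof.
move=> FF FE A [_ [J _ <-] JA]; apply: filterS JA _; apply: filter_bigI.
move=> [[i B] /= /asboolP [C entC CB]] _.
by apply: filterS (FE i C entC) => xy Cxy; apply: CB.
Qed.

Lemma pair_entourage_sub (U V : uniformType)
    (F : set_system ((U * V) * (U * V))) :
  Filter F ->
  (forall E, entourage E -> F [set xy | E (xy.1.1, xy.2.1)]) ->
  (forall E, entourage E -> F [set xy | E (xy.1.2, xy.2.2)]) ->
  entourage `<=` F.
Proof.
move=> FF F1 F2 A [[B C] [/= entB entC] BCA].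
apply: filterS (filterI (F1 _ entB) (F2 _ entC)) => -[[x1 x2] [y1 y2]] [/= Bx Cx].
by have /(_ (conj Bx Cx)) [[[? ?] [? ?]] ? [<- <- <- <-]] := BCA ((x1, y1), (x2, y2)).
Qed.

Lemma snd_entourage (U V : uniformType) (E : set (V * V)) :
  entourage E ->
  entourage [set xy : (U * V) * (U * V) | E (xy.1.2, xy.2.2)].
Proof.
move=> entE; have := prod_entP (@entourageT U) entE.
by apply: filterS => xy [].
Qed.

Lemma fst_mx_entourage (R : realType) (m : nat) (V : uniformType) (e : R) :
  0 < e ->
  entourage [set xy : ('cV[R]_m * V) * ('cV[R]_m * V) |
    forall i, `|xy.1.1 i 0 - xy.2.1 i 0| < e].
Proof.
move=> e0; have entE : entourage [set MN : 'cV[R]_m * 'cV[R]_m |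
    forall i, `|MN.1 i 0 - MN.2 i 0| < e].
  exists (fun _ _ => [set xy : R * R | `|xy.1 - xy.2| < e]).
    move=> i j; rewrite -entourage_ballE; exists e => //.
  by move=> MN /= h i; apply: h.
have := prod_entP entE (@entourageT V).
by apply: filterS => xy [].
Qed.

End ProductEntourages.

(** * The absolute value on a completion *)

Section CompletionMetric.
Variables (R : realType) (K : fieldType) (w : K -> R) (C : completion w).
Implicit Types x y : C.

Lemma cabs_ge0 x : 0 <= cabs x. Proof. exact: absval_ge0 (vabs_absval C) x. Qed.
Lemma cabsM x y : cabs (x * y) = cabs x * cabs y.
Proof. exact: absvalM (vabs_absval C) x y. Qed.
Lemma cabsD x y : cabs (x + y) <= cabs x + cabs y.
Proof. exact: absvalD (vabs_absval C) x y. Qed.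
Lemma cabsN x : cabs (- x) = cabs x. Proof. exact: vabsN. Qed.
Lemma cabs0 : cabs (0 : C) = 0.
Proof. by apply/(absval_eq0 (vabs_absval C)). Qed.
Lemma cabs_cemb a : cabs (cemb C a) = w a. Proof. exact: vabs_vemb. Qed.

Lemma cabs_sum (I : Type) (s : seq I) (F : I -> C) :
  cabs (\sum_(i <- s) F i) <= \sum_(i <- s) cabs (F i).
Proof.
elim: s => [|i s IH]; first by rewrite !big_nil cabs0.
by rewrite !big_cons (le_trans (cabsD _ _)) // lerD2l.
Qed.

Lemma cabs1 : cabs (1 : C) = 1.
Proof.
have h : cabs (1 : C) != 0.
  by apply/eqP => /(absval_eq0 (vabs_absval C)) /eqP; rewrite (oner_eq0 (vfield C)).
by apply: (mulfI h); rewrite -cabsM !mulr1.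
Qed.

Lemma cabsX x k : cabs (x ^+ k) = cabs x ^+ k.
Proof. by elim: k => [|k IH]; rewrite ?cabs1// !exprS cabsM IH. Qed.

Lemma completion_entourageP (E : set (C * C)) : entourage E ->
  exists2 e : R, 0 < e & forall x y, cabs (x - y) < e -> E (x, y).
Proof.
rewrite -entourage_ballE => -[e /= e0 eE]; exists e => // x y xy.
exact: eE.
Qed.

Lemma cabs_compact_bounded (A : set C) : compact A ->
  exists M, forall x, A x -> cabs x <= M.
Proof.
move=> cA; have cont : continuous (@cabs _ _ _ C).
  move=> x; apply/(@cvgrPdist_lt _ _ _ (nbhs x) (nbhs_filter x)) => e e0.
  apply/nbhs_ballP; exists e => // y xy.
  have {xy} xy : cabs (x - y) < e by [].
  have yx : cabs (y - x) < e by rewrite -opprB cabsN.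
  rewrite ltr_norml; apply/andP; split.
  - rewrite ltrNl opprB ltrBlDr (le_lt_trans _ (ltr_leD yx (lexx _)))//.
    by rewrite -{1}(subrK x y) cabsD.
  - rewrite ltrBlDr (le_lt_trans _ (ltr_leD xy (lexx _)))//.
    by rewrite -{1}(subrK y x) cabsD.
have : compact (@cabs _ _ _ C @` A).
  by apply: continuous_compact cA; exact: continuous_subspaceT.
move=> /compact_bounded[M [Mr hM]]; exists (M + 1) => x Ax.
apply: le_trans (ler_norm _) (hM (M + 1) _ _ _); first by rewrite ltrDl.
by exists x.
Qed.

Lemma completion_hausdorff : hausdorff_space C.
Proof. exact: metric_hausdorff. Qed.

End CompletionMetric.

(** * The space K_sigma and its contraction by [alpha] *)

Section RepresentationSpace.
Variables (R : realType) (K : fieldExtType rat) (iota : {rmorphism K -> R}).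
Variable alpha : K.
Variable Kinf : forall w : other_infinite_place iota, completion (sval w).
Variable Kfin : forall w : finite_place_dividing R alpha, completion (sval w).

Notation Ks := (Ksigma Kinf Kfin).

Lemma Ksigma_entourage_sub (F : set_system (Ks * Ks)) : Filter F ->
  (forall w (e : R), 0 < e -> F [set xy | cabs (xy.1.1 w - xy.2.1 w) < e]) ->
  (forall w (e : R), 0 < e -> F [set xy | cabs (xy.1.2 w - xy.2.2 w) < e]) ->
  entourage `<=` F.
Proof.
move=> FF F1 F2; apply: pair_entourage_sub => E.
- move: E; apply: (@prod_topology_entourage_sub _ _
    (fmap (fun xy : Ks * Ks => (xy.1.1, xy.2.1)) F)) => w E.
  move=> /completion_entourageP[e e0 eE].
  by apply: filterS (F1 w e e0) => xy; exact: eE.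
- move: E; apply: (@prod_topology_entourage_sub _ _
    (fmap (fun xy : Ks * Ks => (xy.1.2, xy.2.2)) F)) => w E.
  move=> /completion_entourageP[e e0 eE].
  by apply: filterS (F2 w e e0) => xy; exact: eE.
Qed.

Lemma prod_topology_proj_continuous (I : Type) (T : I -> topologicalType) i :
  continuous (fun f : prod_topology T => f i).
Proof. exact: (@proj_continuous {classic I} T i). Qed.

Lemma Ksigma_coord1_continuous w : continuous (fun x : Ks => x.1 w).
Proof.
move=> x.
apply: (@continuous_comp Ks _ _ fst (fun f : prod_topology _ => f w) x).
  exact: cvg_fst.
exact: (@prod_topology_proj_continuous _ (fun w => Kinf w : topologicalType) w).
Qed.

Lemma Ksigma_coord2_continuous w : continuous (fun x : Ks => x.2 w).
Proof.
move=> x.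
apply: (@continuous_comp Ks _ _ snd (fun f : prod_topology _ => f w) x).
  exact: cvg_snd.
exact: (@prod_topology_proj_continuous _ (fun w => Kfin w : topologicalType) w).
Qed.

Lemma Ksigma_compact_bounded1 (B : set Ks) w : compact B ->
  exists M, forall x, B x -> cabs (x.1 w) <= M.
Proof.
move=> cB; have : compact ((fun x : Ks => x.1 w) @` B).
  apply: continuous_compact cB; apply: continuous_subspaceT.
  exact: Ksigma_coord1_continuous.
move=> /cabs_compact_bounded[M hM]; exists M => x Bx; apply: hM.
by exists x.
Qed.

Lemma Ksigma_compact_bounded2 (B : set Ks) w : compact B ->
  exists M, forall x, B x -> cabs (x.2 w) <= M.
Proof.
move=> cB; have : compact ((fun x : Ks => x.2 w) @` B).
  apply: continuous_compact cB; apply: continuous_subspaceT.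
  exact: Ksigma_coord2_continuous.
move=> /cabs_compact_bounded[M hM]; exists M => x Bx; apply: hM.
by exists x.
Qed.

Lemma continuous_cluster (T U : topologicalType) (f : T -> U) (p q : T) :
  continuous f -> cluster (nbhs p) q -> cluster (nbhs (f p)) (f q).
Proof.
move=> cf pq A B /cf fA /cf fB.
by have [x [Ax Bx]] := pq _ _ fA fB; exists (f x).
Qed.

Lemma Ksigma_hausdorff : hausdorff_space Ks.
Proof.
move=> [p1 p2] [q1 q2] pq; congr pair; apply: functional_extensionality_dep => w.
- apply: (@completion_hausdorff _ _ _ (Kinf w)).
  exact: (continuous_cluster (@Ksigma_coord1_continuous w) pq).
- apply: (@completion_hausdorff _ _ _ (Kfin w)).
  exact: (continuous_cluster (@Ksigma_coord2_continuous w) pq).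
Qed.

Lemma KaddA : associative (@Kadd R K iota alpha Kinf Kfin).
Proof.
move=> x y z; rewrite /Kadd; congr pair; apply: functional_extensionality_dep => w /=;
exact: addrA.
Qed.

Lemma Kadd_Phi x y : Kadd (Phi Kinf Kfin x) (Phi Kinf Kfin y) = Phi Kinf Kfin (x + y).
Proof.
rewrite /Kadd/Phi; congr pair; apply: functional_extensionality_dep => w /=;
by rewrite rmorphD.
Qed.

Lemma Kact_Phi x y : Kact x (Phi Kinf Kfin y) = Phi Kinf Kfin (x * y).
Proof.
rewrite /Kact/Phi; congr pair; apply: functional_extensionality_dep => w /=;
by rewrite rmorphM.
Qed.

Lemma Kact_Kadd x (y z : Ks) : Kact x (Kadd y z) = Kadd (Kact x y) (Kact x z).
Proof.
rewrite /Kact/Kadd; congr pair; apply: functional_extensionality_dep => w /=;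
by rewrite mulrDr.
Qed.

Lemma Kact_M x y (z : Ks) : Kact x (Kact y z) = Kact (x * y) z.
Proof.
rewrite /Kact; congr pair; apply: functional_extensionality_dep => w /=;
by rewrite rmorphM mulrA.
Qed.

Lemma Kact1 (z : Ks) : Kact 1 z = z.
Proof.
case: z => z1 z2; rewrite /Kact; congr pair; apply: functional_extensionality_dep => w /=;
by rewrite rmorph1 mul1r.
Qed.

Lemma Kadd_Phi0 (z : Ks) : Kadd (Phi Kinf Kfin 0) z = z.
Proof.
case: z => z1 z2; rewrite /Kadd; congr pair; apply: functional_extensionality_dep => w /=;
by rewrite rmorph0 add0r.
Qed.

(** The difference is [alpha ^+ k] times [x - y], of absolute value at most (w alpha)^k (M1 + M2),
    whatever [z] is. *)
Lemma cabs_tail_lt (w : K -> R) (C : completion w) (B1 B2 : set C) (M1 M2 e : R) :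
  w alpha < 1 -> (forall x, B1 x -> cabs x <= M1) ->
  (forall x, B2 x -> cabs x <= M2) -> 0 < e ->
  \forall k \near \oo, forall z x y, B1 x -> B2 y ->
    cabs (z + cemb C (alpha ^+ k) * x - (z + cemb C (alpha ^+ k) * y)) < e.
Proof.
move=> w1 h1 h2 e0.
have w0 : 0 <= w alpha by rewrite -(cabs_cemb C); exact: cabs_ge0.
have M0 : 0 < `|M1| + `|M2| + 1 by rewrite ltr_wpDl// addr_ge0.
have : (fun k => w alpha ^+ k) @ \oo --> (0 : R).
  by apply: cvg_expr; rewrite ger0_norm.
move=> /cvgrPdist_lt /(_ _ (divr_gt0 e0 M0)); apply: filterS => k.
rewrite sub0r normrN ger0_norm ?exprn_ge0// ltr_pdivlMr// => wk z x y Bx By.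
rewrite opprD addrACA subrr add0r -mulrBr cabsM cabs_cemb.
have -> : w (alpha ^+ k) = w alpha ^+ k.
  by rewrite -!(cabs_cemb C) rmorphXn cabsX.
apply: le_lt_trans wk; rewrite ler_wpM2l ?exprn_ge0//.
rewrite (le_trans (cabsD _ _))// cabsN -[leLHS]addr0 !lerD//.
- exact: le_trans (h1 _ Bx) (ler_norm _).
- exact: le_trans (h2 _ By) (ler_norm _).
Qed.

Hypothesis infinite_contract : forall w : other_infinite_place iota, sval w alpha < 1.

(** Compact sets have bounded coordinates, and [alpha] contracts each of them. The relations that
    eventually hold form a filter [F], which reduces the claim to single places. *)
Lemma Ksigma_tail_entourage (B1 B2 : set Ks) (E : set (Ks * Ks)) :
  compact B1 -> compact B2 -> entourage E ->
  \forall k \near \oo, forall z x y, B1 x -> B2 y ->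
    E (Kadd z (Kact (alpha ^+ k) x), Kadd z (Kact (alpha ^+ k) y)).
Proof.
move=> c1 c2; move: E.
pose F : set_system (Ks * Ks) := [set E | \forall k \near \oo, forall z x y,
  B1 x -> B2 y ->
  E (Kadd z (Kact (alpha ^+ k) x), Kadd z (Kact (alpha ^+ k) y))].
have FF : Filter F.
  split.
  - exact: nearW.
  - move=> P Q; rewrite /F /=; apply: filterS2 => k hP hQ z x y Bx By.
    by split; [exact: hP|exact: hQ].
  - by move=> P Q PQ; rewrite /F /=; apply: filterS => k hP z x y Bx By; apply/PQ/hP.
apply: (@Ksigma_entourage_sub F FF) => w e e0.
- have [M1 hM1] := Ksigma_compact_bounded1 w c1.
  have [M2 hM2] := Ksigma_compact_bounded1 w c2.
  have := @cabs_tail_lt _ (Kinf w) ((fun x : Ks => x.1 w) @` B1)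
    ((fun x : Ks => x.1 w) @` B2) M1 M2 e (infinite_contract w).
  have h1 x : [set x.1 w | x in B1] x -> cabs x <= M1 by move=> [y /hM1 ? <-].
  have h2 x : [set x.1 w | x in B2] x -> cabs x <= M2 by move=> [y /hM2 ? <-].
  move=> /(_ h1 h2 e0); apply: filterS => k hk z x y Bx By.
  by apply: hk; [exists x|exists y].
- have [M1 hM1] := Ksigma_compact_bounded2 w c1.
  have [M2 hM2] := Ksigma_compact_bounded2 w c2.
  have := @cabs_tail_lt _ (Kfin w) ((fun x : Ks => x.2 w) @` B1)
    ((fun x : Ks => x.2 w) @` B2) M1 M2 e (svalP w).2.
  have h1 x : [set x.2 w | x in B1] x -> cabs x <= M1 by move=> [y /hM1 ? <-].
  have h2 x : [set x.2 w | x in B2] x -> cabs x <= M2 by move=> [y /hM2 ? <-].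
  move=> /(_ h1 h2 e0); apply: filterS => k hk z x y Bx By.
  by apply: hk; [exists x|exists y].
Qed.

End RepresentationSpace.

(** * Digit sums of walks in the prefix automaton *)

Section Walks.
Variables (n : nat) (sigma : 'I_n -> seq 'I_n).
Variables (K : fieldExtType rat) (alpha : K) (v : 'rV[K]_n).

(** Both the start [b] and the end [a] are recorded, so that walks can be concatenated; the values
    lie in [K], where [iota] and [Phi] both apply. *)
Definition walk_sums (k : nat) (b a : 'I_n) : set K :=
  [set x | exists c p, [/\ prefix_walk sigma k c p a, c k = b
     & x = \sum_(i < k) delta v (p i) * alpha ^+ i]].

Lemma walk_sums0 a : walk_sums 0 a a 0.
Proof. by exists (fun=> a), (fun=> [::]); split; rewrite ?big_ord0. Qed.

Lemma walk_sums0E b a x : walk_sums 0 b a x -> b = a /\ x = 0.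
Proof. by move=> [c [p [[ca _] cb ->]]]; rewrite big_ord0 -cb ca. Qed.

Lemma walk_sums_cat k m b d a x y : walk_sums k b a x -> walk_sums m d b y ->
  walk_sums (k + m) d a (x + alpha ^+ k * y).
Proof.
move=> [c [p [[c0 cp] ck ->]]] [c' [p' [[c'0 cp'] c'm ->]]].
(* The walks share the letter at index [k], but the prefix at [k] already belongs to the second one;
   hence the two different comparisons. *)
exists (fun i => if (i <= k)%N then c i else c' (i - k)%N).
exists (fun i => if (i < k)%N then p i else p' (i - k)%N).
split.
- split=> [|i ikm]; first by rewrite leq0n.
  have [ik|ki] := ltnP i k; first by rewrite (ltnW ik); exact: cp.
  have := cp' (i - k)%N; rewrite subSn//.
  have -> : (i - k < m)%N by rewrite ltn_subLR.
  move=> /(_ isT); case: ifP => // ik.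
  have -> : i = k by apply/eqP; rewrite eqn_leq ik.
  by rewrite subnn c'0 ck.
- case: m {cp'} c'm => [|m] c'm; first by rewrite addn0 leqnn ck -c'0.
  by rewrite addnS ltnNge leq_addr -addnS addKn.
- rewrite big_split_ord /= mulr_sumr; congr (_ + _); apply: eq_bigr => i _.
  + by rewrite ltn_ord.
  + by rewrite ltnNge leq_addr /= addKn exprD mulrCA.
Qed.

Lemma walk_sums_edge b p a : prefix_edge sigma b p a -> walk_sums 1 b a (delta v p).
Proof.
move=> ba; exists (fun i => if i is 0%N then a else b), (fun=> p); split=> //.
- by split=> // -[].
- by rewrite big_ord1 mulr1.
Qed.

Lemma walk_sumsS k d a x : walk_sums k.+1 d a x ->
  exists b p y, [/\ prefix_edge sigma d p b, walk_sums k b a y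
    & x = y + alpha ^+ k * delta v p].
Proof.
move=> [c [p [[c0 cp] ck ->]]]; exists (c k), (p k).
exists (\sum_(i < k) delta v (p i) * alpha ^+ i); split.
- by rewrite -ck; exact: cp.
- by exists c, p; split=> //; split=> // i ik; apply: cp; exact: ltnW.
- by rewrite big_ord_recr /= mulrC.
Qed.

(** Induction on the top edge: its prefix is one of the finitely many [take i (sigma d)]. *)
Lemma walk_sums_finite k b a : finite_set (walk_sums k b a).
Proof.
elim: k b => [|k IH] d.
  by apply: (@sub_finite_set _ _ [set 0]) => // x /walk_sums0E[].
pose P := [set take i (sigma d) | i in `I_(size (sigma d)).+1].
pose f (y : K) p := y + alpha ^+ k * delta v p.
apply: (@sub_finite_set _ _
  (\bigcup_(b in [set: 'I_n]) [set f yp.1 yp.2 | yp in walk_sums k b a `*` P])).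
  move=> x /walk_sumsS[b [p [y [[s sd] wy ->]]]]; exists b => //.
  exists (y, p) => //; split=> //; exists (size p) => /=.
    by rewrite sd size_cat ltnS leq_addr.
  by rewrite sd take_size_cat.
apply: bigcup_finite => // b _; apply: finite_image; apply: finite_setX => //.
exact: finite_image.
Qed.

End Walks.

(** * Walks with empty prefixes, and primitivity *)

Section FirstLetter.
Variables (n : nat) (sigma : 'I_n -> seq 'I_n).
Variables (K : fieldExtType rat) (alpha : K) (v : 'rV[K]_n).
Hypothesis sigma_nonempty : forall b, sigma b != [::].

Lemma delta_nil : delta v [::] = 0.
Proof. by rewrite /delta /pairQ big1// => i _; rewrite !mxE scale0r. Qed.

(** The edge from [c] to the first letter of [sigma c] has the empty prefix, hence digit 0. The
    default of [head] never occurs, as [sigma c] is non-empty. *)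
Lemma walk_sums_first_letter m b :
  walk_sums sigma alpha v m b (iter m (fun c => head c (sigma c)) b) 0.
Proof.
elim: m => [|m IH] /=; first exact: walk_sums0.
set f := fun _ => _ in IH *; set c := iter m f b in IH *.
have := @walk_sums_cat _ sigma _ alpha v 1 m c b (f c) 0 0.
rewrite add0r mulr0 add1n; apply=> //; rewrite -delta_nil.
apply: walk_sums_edge; rewrite /f; case E : (sigma c) => [|d s].
  by move: (sigma_nonempty c); rewrite E.
by exists s.
Qed.

(* b0 lies on a cycle of the map sending a letter to the first letter of its image. *)
Lemma recurrent_letter (a : 'I_n) :
  exists b0, forall m, exists b, walk_sums sigma alpha v m b b0 0.
Proof.
pose f c := head c (sigma c).
have /trajectP[i io fi] : iter (order f a) f a \in traject f a (order f a).
  exact: looping_order.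
exists (iter i f a) => m.
have fq q : iter q (iter (order f a - i) f) (iter i f a) = iter i f a.
  by elim: q => //= q ->; rewrite -iterD subnK ?fi// ltnW.
have := fq m; rewrite -iterM.
have mq : (m <= m * (order f a - i))%N by rewrite leq_pmulr// subn_gt0.
rewrite -(subnKC mq) iterD => E.
(* Stopping [m] steps short of [m] full periods gives the letter from which [m] steps lead back. *)
set b := iter (_ - m) f _ in E.
by exists b; rewrite -E; exact: walk_sums_first_letter.
Qed.

(** The entry counts walks of length [k] from [b] to [a]; a non-zero sum has a non-zero term, which
    supplies the letter before the top edge. *)
Lemma incidence_exp_walk k a b : (incidence sigma int ^+ k) a b != 0 ->
  exists x, walk_sums sigma alpha v k b a x.
Proof.
elim: k b => [|k IH] b.
  rewrite expr0 mxE; case: (eqVneq a b) => [-> _|_]; last by rewrite eqxx.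
  by exists 0; exact: walk_sums0.
rewrite exprSr mxE => h.
have [j jP] : exists j, (incidence sigma int ^+ k) a j * incidence sigma int j b != 0.
  apply: contrapT => hN; move/eqP: h; apply; apply: big1 => j _.
  by apply/eqP/negPn/negP => jN; apply: hN; exists j.
move: jP; rewrite mulf_eq0 negb_or => /andP[/IH[x wx]].
rewrite mxE pnatr_eq0 -lt0n -has_count has_pred1 => jb.
have [p bj] : exists p, prefix_edge sigma b p j.
  by rewrite /prefix_edge; case/splitPr: jb => p s; exists p, s.
exists (x + alpha ^+ k * delta v p).
by rewrite -addn1; apply: (walk_sums_cat wx); exact: walk_sums_edge.
Qed.

Lemma primitive_walk : primitive_incidence sigma -> exists m, forall b c,
  exists x, walk_sums sigma alpha v m b c x.
Proof.
move=> [m _ mP]; exists m => b c.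
apply: incidence_exp_walk.
by have := mP c b; rewrite lt0r => /andP[].
Qed.

End FirstLetter.

(** * Approximation of the dual prototile by digit sums *)

Section DualPrototile.
Variables (R : realType) (n : nat) (sigma : 'I_n -> seq 'I_n).
Variables (K : fieldExtType rat) (iota : {rmorphism K -> R}) (alpha : K).
Variable v : 'rV[K]_n.
Variable Kinf : forall w : other_infinite_place iota, completion (sval w).
Variable Kfin : forall w : finite_place_dividing R alpha, completion (sval w).
Variable Omega : 'I_n -> set (Ksigma Kinf Kfin).

Hypothesis infinite_contract : forall w : other_infinite_place iota, sval w alpha < 1.
Hypothesis OmegaP : is_dual_prototile sigma v Omega.

Notation Phi := (Phi Kinf Kfin).
Notation walks := (walk_sums sigma alpha v).

Lemma Omega_walk k b a x y : walks k b a x -> Omega b y ->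
  Omega a (Kadd (Phi x) (Kact (alpha ^+ k) y)).
Proof.
have [_ _ OmegaE] := OmegaP; elim: k b x y => [|k IH] d x y.
  by move=> /walk_sums0E[-> ->]; rewrite Kadd_Phi0 expr0 Kact1.
move=> /walk_sumsS[b [p [z [db wz ->]]]] dy.
rewrite -Kadd_Phi -Kact_Phi exprSr -Kact_M -KaddA -Kact_Kadd.
apply: IH wz _; rewrite OmegaE; exists d, p; split=> //; exists y => //.
rewrite /Kadd; congr pair; apply: functional_extensionality_dep => w /=;
exact: addrC.
Qed.

Lemma Omega_expand k a y : Omega a y -> exists b x z,
  [/\ walks k b a x, Omega b z & y = Kadd (Phi x) (Kact (alpha ^+ k) z)].
Proof.
have [_ _ OmegaE] := OmegaP; move=> ay; elim: k => [|k [b [x [z [wx bz ->]]]]].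
  exists a, 0, y; split=> //; first exact: walk_sums0.
  by rewrite Kadd_Phi0 expr0 Kact1.
move: bz; rewrite OmegaE => -[d [p [db [t dt ->]]]].
exists d, (x + alpha ^+ k * delta v p), t; split=> //.
  by rewrite -addn1; apply: (walk_sums_cat wx); exact: walk_sums_edge.
rewrite -Kadd_Phi -Kact_Phi exprSr -Kact_M -KaddA -Kact_Kadd; congr Kadd; congr Kact.
rewrite /Kadd; congr pair; apply: functional_extensionality_dep => w /=;
exact: addrC.
Qed.

Lemma Phi_tail x k z :
  Kadd (Phi x) (Kact (alpha ^+ k) (Phi z)) = Phi (x + alpha ^+ k * z).
Proof. by rewrite Kact_Phi Kadd_Phi. Qed.

Lemma Omega_closed a : closed (Omega a).
Proof.
have [_ cO _] := OmegaP.
exact: (compact_closed (@Ksigma_hausdorff _ _ _ _ _ _) (cO a)).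
Qed.

(* A walk from b of length k may be prolonged by the m-step walk of sum t b
   starting at d: this perturbs its point by alpha^k (t b) only. *)
Lemma Omega_approx (m : nat) (d : 'I_n) (t : 'I_n -> K) a y U :
  (forall b, walks m d b (t b)) -> Omega a y -> nbhs y U ->
  \forall k \near \oo, exists2 x, walks (k + m) d a x & U (Phi x).
Proof.
move=> dt ay; rewrite -nbhs_entourageE => -[E entE EU].
have [_ cO _] := OmegaP.
(* Both the tail in [Omega b] and its replacement [Phi (t b)] lie in compact sets, so scaling by
   [alpha ^+ k] brings them together. *)
have : forall b, \forall k \near \oo, forall z x x', Omega b x ->
    [set Phi (t b)] x' ->
    E (Kadd z (Kact (alpha ^+ k) x), Kadd z (Kact (alpha ^+ k) x')).
  move=> b; apply: Ksigma_tail_entourage => //.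
  exact: compact_set1.
move=> /filter_forall hF; apply: filterS hF => k hk.
have [b [x [z [wx bz yE]]]] := Omega_expand k ay.
exists (x + alpha ^+ k * t b); first by apply: walk_sums_cat wx _; exact: dt.
by apply: EU; apply/xsectionP; rewrite -Phi_tail yE; exact: (hk b _ z _ bz erefl).
Qed.

(** Adding [alpha ^+ k] times a point of [Omega b] to [Phi x] gives a point of [Omega a], close to
    [Phi x] for large [k]; and [Omega a] is closed. *)
Lemma Omega_limsup a y :
  (forall U, nbhs y U -> forall N, exists2 k, (N <= k)%N &
    exists b x, walks k b a x /\ U (Phi x)) -> Omega a y.
Proof.
move=> h; apply: Omega_closed => U; rewrite -nbhs_entourageE => -[E entE EU].
have [Ome0 cO _] := OmegaP.
have : forall b, \forall k \near \oo, forall z x x', [set Phi 0] x ->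
    Omega b x' ->
    split_ent E (Kadd z (Kact (alpha ^+ k) x), Kadd z (Kact (alpha ^+ k) x')).
  move=> b; apply: Ksigma_tail_entourage => //.
  exact: compact_set1.
move=> /filter_forall[N _ hN].
have [] := h (xsection (split_ent E) y) _ N.
  by rewrite -nbhs_entourageE; exists (split_ent E).
move=> k Nk [b [x [wx /xsectionP yx]]].
have [z bz] := Ome0 b.
exists (Kadd (Phi x) (Kact (alpha ^+ k) z)); split; first exact: Omega_walk bz.
apply: EU; apply/xsectionP; apply: (entourage_split _ entE yx).
have := hN k Nk b (Phi x) (Phi 0) z erefl bz.
by rewrite Phi_tail mulr0 addr0.
Qed.

End DualPrototile.

(** * Embeddings of [K] and the incidence matrix *)

Section PisotData.
Variables (R : realType) (n : nat) (sigma : 'I_n -> seq 'I_n).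
Variables (K : fieldExtType rat) (iota : {rmorphism K -> R}) (alpha : K).
Variable v : 'rV[K]_n.
Hypothesis v_eigen : v *m incidence sigma K = alpha *: v.
Hypothesis v_neq0 : v != 0.

Lemma map_incidence (A B : nzRingType) (f : {rmorphism A -> B}) :
  map_mx f (incidence sigma A) = incidence sigma B.
Proof. by apply/matrixP => i j; rewrite !mxE rmorph_nat. Qed.

Lemma char_poly_incidence_root (L : numFieldType) (f : {rmorphism K -> L}) :
  root (map_poly ratr (char_poly (incidence sigma rat))) (f alpha).
Proof.
rewrite map_char_poly map_incidence -eigenvalue_root_char.
apply/eigenvalueP; exists (map_mx f v); last by rewrite map_mx_eq0.
by rewrite -(map_incidence f) -map_mxM v_eigen map_mxZ.
Qed.

Lemma conjugate_embedding (phi : {rmorphism K -> R[i]}) :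
  irreducible_poly (char_poly (incidence sigma rat)) ->
  is_conjugate (iota alpha) (phi alpha).
Proof.
move=> irr; exists (char_poly (incidence sigma rat)).
by split=> //; exact: char_poly_incidence_root.
Qed.

Lemma embedding_eq (L : fieldType) (f g : {rmorphism K -> L}) :
  <<1; alpha>>%VS = {: K}%VS -> f alpha = g alpha -> f =1 g.
Proof.
move=> gen fg x; have : x \in <<1; alpha>>%VS by rewrite gen memvf.
move=> /Fadjoin_polyP[p /polyOver1P[q ->] ->].
have E (h : {rmorphism K -> L}) : h (map_poly (in_alg K) q).[alpha] =
    (map_poly (h \o in_alg K) q).[h alpha].
  by rewrite -horner_map -map_poly_comp.
rewrite !E fg; congr (_.[_]); apply: eq_map_poly => r /=.
have := fmorph_eq_rat (f \o in_alg K) r.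
have := fmorph_eq_rat (g \o in_alg K) r.
by move=> /= -> ->.
Qed.

(** If [phi alpha] were [iota alpha], [phi] would agree with [iota] and give the excluded place; so
    [phi alpha] is another conjugate of [iota alpha]. *)
Lemma other_infinite_place_lt1 (w : other_infinite_place iota) :
  is_irreducible_pisot sigma (iota alpha) -> <<1; alpha>>%VS = {: K}%VS ->
  sval w alpha < 1.
Proof.
move=> [_ irr _ [_ _ conj_lt1]] gen; case: w => w [[phi wE] w_iota] /=.
rewrite wE; apply: conj_lt1; first exact: conjugate_embedding.
apply/eqP => phi_alpha; apply: w_iota; rewrite wE; apply/funext => x.
have -> : phi x = (iota x)%:C%C.
  exact: (@embedding_eq _ phi (real_complex R \o iota : {rmorphism K -> R[i]})).
by rewrite /Normc.normc /= expr0n /= addr0 sqrtr_sqr.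
Qed.

(** If the determinant vanished, X would divide the irreducible characteristic polynomial, hence be
    proportional to it, and the root [iota alpha] would be 0. *)
Lemma incidence_unit : irreducible_poly (char_poly (incidence sigma rat)) ->
  alpha != 0 -> incidence sigma rat \in unitmx.
Proof.
move=> [_ irr] a0; set p := char_poly _ in irr; rewrite unitmxE unitfE.
apply/negP => /eqP det0.
have p0 : root p 0.
  by rewrite /root horner_coef0 char_poly_det det0 mulr0.
have := irr 'X; rewrite size_polyX => /(_ isT).
have -> : 'X %| p by rewrite -['X]subr0 -polyC0 dvdp_XsubCl.
move=> /(_ isT) /eqpP[[c d] /andP[/= c0 d0] cd].
have /rootP pa : root (map_poly (ratr : {rmorphism rat -> R}) p) (iota alpha).
  exact: char_poly_incidence_root.
have /(congr1 (fun q => (map_poly (ratr : {rmorphism rat -> R}) q).[iota alpha])) := cd.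
rewrite !map_polyZ /= map_polyX !hornerZ hornerX pa mulr0 => /eqP.
by rewrite mulf_eq0 !fmorph_eq0 (negPf c0) (negPf a0).
Qed.

Lemma pairQE (x : 'cV[rat]_n) : pairQ v x = (v *m map_mx (in_alg K) x) 0 0.
Proof.
by rewrite mxE; apply: eq_bigr => i _; rewrite mxE mulrC -scalerAl mul1r.
Qed.

Lemma pairQD (x y : 'cV[rat]_n) : pairQ v (x + y) = pairQ v x + pairQ v y.
Proof. by rewrite !pairQE map_mxD mulmxDr mxE. Qed.

Lemma pairQ_incidence x : pairQ v (incidence sigma rat *m x) = alpha * pairQ v x.
Proof.
by rewrite !pairQE map_mxM map_incidence mulmxA v_eigen -scalemxAl mxE.
Qed.

End PisotData.

(** * Local finiteness of the digit sums in the reals *)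

Section Discreteness.
Variables (R : realType) (n : nat) (sigma : 'I_n -> seq 'I_n).
Variables (K : fieldExtType rat) (iota : {rmorphism K -> R}) (alpha : K).
Variable v : 'rV[K]_n.
Hypothesis alpha_gt1 : 1 < iota alpha.
Hypothesis v_gt0 : forall i, 0 < iota (v 0 i).

Notation walks := (walk_sums sigma alpha v).

(** Positivity of the weights bounds non-zero digits from below, which makes the digit sums locally
    finite. *)
Lemma iota_delta_cons b p : iota (v 0 b) <= iota (delta v (b :: p)).
Proof.
have -> : iota (delta v (b :: p)) =
    \sum_i (count_mem i (b :: p))%:R * iota (v 0 i).
  rewrite /delta /pairQ rmorph_sum; apply: eq_bigr => i _.
  by rewrite mxE scaler_nat rmorphMn mulr_natl.
rewrite (bigD1 b)//= -[leLHS]addr0 lerD//.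
  by rewrite eqxx add1n ler_peMl ?ler1n// ltW.
by apply: sumr_ge0 => i _; rewrite mulr_ge0 ?ler0n// ltW.
Qed.

Lemma iota_delta_ge0 p : 0 <= iota (delta v p).
Proof.
case: p => [|b p]; first by rewrite delta_nil rmorph0.
exact: le_trans (ltW (v_gt0 b)) (iota_delta_cons b p).
Qed.

Lemma iota_walk_ge0 k b a x : walks k b a x -> 0 <= iota x.
Proof.
move=> [c [p [_ _ ->]]]; rewrite rmorph_sum sumr_ge0// => i _.
by rewrite rmorphM rmorphXn mulr_ge0 ?iota_delta_ge0// exprn_ge0// (le_trans ler01) ?ltW.
Qed.

(* A non-empty prefix at height k contributes at least alpha^k min v, so large
   heights carry only empty prefixes. *)
Lemma bounded_walk_finite (a : 'I_n) (B : R) :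
  finite_set [set x | exists k b, walks k b a x /\ iota x <= B].
Proof.
have [N hN] : exists N, forall k c, (N <= k)%N -> B < iota alpha ^+ k * iota (v 0 c).
  have : forall c, \forall k \near \oo, B < iota alpha ^+ k * iota (v 0 c).
    move=> c; have : (fun k => (iota alpha)^-1 ^+ k) @ \oo --> (0 : R).
      apply: cvg_expr; rewrite ger0_norm ?invr_ge0 ?(ltW (lt_trans ltr01 _))//.
      by rewrite invf_lt1// (lt_trans ltr01).
    have B0 : 0 < iota (v 0 c) / (`|B| + 1) by rewrite divr_gt0// ltr_wpDl.
    move=> /cvgrPdist_lt /(_ _ B0); apply: filterS => k.
    have ak : 0 < iota alpha ^+ k by rewrite exprn_gt0// (lt_trans ltr01).
    rewrite sub0r normrN exprVn ger0_norm ?invr_ge0 ?ltW//.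
    rewrite ltr_pdivlMr ?ltr_wpDl// ltr_pdivrMl// => h.
    by rewrite (le_lt_trans _ h)// (le_trans (ler_norm B))// lerDl.
  by move=> /filter_forall[N _ hN]; exists N => k c Nk; exact: hN.
apply: (@sub_finite_set _ _
  (\bigcup_(j in `I_N.+1) \bigcup_(b in [set: 'I_n]) walks j b a)); last first.
  apply: bigcup_finite => // j _; apply: bigcup_finite => // b _.
  exact: walk_sums_finite.
move=> x [k [b [+ +]]]; elim: k b x => [|k IH] b x wx xB.
  by exists 0%N => //; exists b.
have [kN|Nk] := ltnP k N; first by exists k.+1 => //; exists b.
have [d [p [y [_ wy xE]]]] := walk_sumsS wx.
(* A top edge with empty prefix contributes nothing and is dropped, until the length is at most
   [N]. *)
case: p xE => [|c p] xE.
  by apply: (IH d); rewrite xE delta_nil mulr0 addr0 in xB *.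
have := hN k c Nk; rewrite ltNge => /negP[]; apply: le_trans xB.
rewrite xE rmorphD rmorphM rmorphXn -[leLHS]add0r lerD ?(iota_walk_ge0 wy)//.
by rewrite ler_wpM2l ?iota_delta_cons// exprn_ge0// (le_trans ler01) ?ltW.
Qed.

Lemma DT_integersE a k :
  DT_integers sigma iota alpha v a k = iota @` [set x | exists b, walks k b a x].
Proof.
have E (p : nat -> seq 'I_n) : iota (\sum_(i < k) delta v (p i) * alpha ^+ i) =
    \sum_(i < k) iota (delta v (p i)) * iota alpha ^+ i.
  by rewrite rmorph_sum; apply: eq_bigr => i _; rewrite rmorphM rmorphXn.
apply/seteqP; split=> [_ [c [p [cp ->]]]|_ [_ [b [c [p [cp _ ->]]]] <-]].
  by exists (\sum_(i < k) delta v (p i) * alpha ^+ i) => //; exists (c k), c, p.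
by exists c, p.
Qed.

(** By local finiteness [x] has a neighbourhood that meets no digit sum other than [x], so
    sufficiently near sums equal [x]. *)
Lemma DT_limsup a x :
  kuratowski_limsup (DT_integers sigma iota alpha v a) x ->
  forall N, exists2 k, (N <= k)%N & DT_integers sigma iota alpha v a k x.
Proof.
move=> xlim N.
pose S := [set y | exists k b, walks k b a y /\ iota y <= x + 1].
have finS : finite_set ((iota @` S) `\ x).
  by apply: finite_setD; apply: finite_image; exact: bounded_walk_finite.
have U : nbhs x (~` ((iota @` S) `\ x) `&` [set y | y < x + 1]).
  apply: filterI; last by apply: lt_nbhsl; rewrite ltrDl.
  apply: open_nbhs_nbhs; split; last by move=> [_ /(_ erefl)].
  apply: closed_openC; apply: accessible_finite_set_closed.1 finS.
  exact/hausdorff_accessible/Rhausdorff.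
have [k Nk [y [yk [yS /= yx]]]] := xlim _ U N.
exists k => //; have [<-//|yNx] := eqVneq y x.
move: yk; rewrite DT_integersE => -[z [b wz] zy].
exfalso; apply: yS; split; last exact/eqP.
by exists z => //; exists k, b; split=> //; rewrite zy ltW.
Qed.

Lemma DT_liminf a x N :
  (forall k, (N <= k)%N -> DT_integers sigma iota alpha v a k x) ->
  kuratowski_liminf (DT_integers sigma iota alpha v a) x.
Proof.
move=> h U /nbhs_singleton Ux; exists N => // k Nk.
by exists x; split=> //; exact: h.
Qed.

End Discreteness.

(** * Auxiliary facts on continuity, eigenvectors and rational scalars *)

Lemma unif_continuous_continuous (U V : uniformType) (f : U -> V) :
  unif_continuous f -> continuous f.
Proof.
move=> uf x A; rewrite -nbhs_entourageE => -[E entE EA].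
suff : nbhs x (f @^-1` A) by [].
rewrite -nbhs_entourageE; exists ((fun xy => (f xy.1, f xy.2)) @^-1` E).
  exact: uf.
by move=> y /xsectionP xy; apply: EA; exact/xsectionP.
Qed.

Lemma mulVmx_exp (F : fieldType) (n : nat) (M : 'M[F]_n) k : M \in unitmx ->
  invmx M ^+ k *m M ^+ k = 1%:M.
Proof.
move=> uM; elim: k => [|k IH]; first by rewrite mulmx1.
by rewrite exprS exprSr !mulmxA -(mulmxA (invmx M)) IH mulmx1 mulVmx.
Qed.

Lemma eigenvectors_mulmx0 (F : fieldType) (n : nat) (M : 'M[F]_n) (V : 'rV[F]_n)
    (U : 'cV[F]_n) (a b : F) :
  V *m M = a *: V -> M *m U = b *: U -> a != b -> V *m U = 0.
Proof.
move=> VM MU ab; apply/eqP; have : (a - b) *: (V *m U) == 0.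
  by rewrite scalerBl scalemxAl -VM -mulmxA MU -scalemxAr subrr.
by rewrite scaler_eq0 subr_eq0 (negPf ab).
Qed.

Lemma rmorph_scale_rat (R : realType) (K : fieldExtType rat) (F : fieldType)
    (f : {rmorphism R -> F}) (g : {rmorphism K -> F}) (q : rat) (y : K) :
  g (q *: y) = f (ratr q) * g y.
Proof.
rewrite -mulr_algl rmorphM; congr (_ * _).
have fE := fmorph_eq_rat (f \o (ratr : {rmorphism rat -> R})) q.
exact: etrans (fmorph_eq_rat (g \o in_alg K) q) (esym fE).
Qed.

(** * The map G on the approximations of the E_1^* subtile *)

Section E1Subtile.
Variables (R : realType) (n : nat) (sigma : 'I_n -> seq 'I_n).
Variables (K : fieldExtType rat) (iota : {rmorphism K -> R}) (alpha : K).
Variables (v : 'rV[K]_n) (u : 'cV[R]_n).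
Variable Kinf : forall w : other_infinite_place iota, completion (sval w).
Variable Kfin : forall w : finite_place_dividing R alpha, completion (sval w).
Variable rho : forall w : other_infinite_place iota, {rmorphism R -> Kinf w}.

Hypothesis infinite_contract : forall w : other_infinite_place iota, sval w alpha < 1.
Hypothesis alpha_gt1 : 1 < iota alpha.
Hypothesis v_eigen : v *m incidence sigma K = alpha *: v.
Hypothesis u_eigen : incidence sigma R *m u = iota alpha *: u.
Hypothesis rho_isometric : forall w t, cabs (rho w t) = `|t|.
Hypothesis incidence_unit : incidence sigma rat \in unitmx.

Notation walks := (walk_sums sigma alpha v).
Notation Phi := (Phi Kinf Kfin).
Notation G := (Gmap v rho).
Notation Psi := (Psi v Kfin).

(** The images of [v] and [u] in [Kinf w] are a left and a right eigenvector for distinct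
    eigenvalues: one has absolute value below 1, the other above 1. *)
Lemma eigenvectors_orthogonal w :
  \sum_i rho w (u i 0) * cemb (Kinf w) (v 0 i) = 0.
Proof.
pose V := map_mx (cemb (Kinf w)) v; pose U := map_mx (rho w) u.
have VM : V *m incidence sigma (Kinf w) = cemb (Kinf w) alpha *: V.
  by rewrite -(map_incidence _ (cemb (Kinf w))) -map_mxM v_eigen map_mxZ.
have MU : incidence sigma (Kinf w) *m U = rho w (iota alpha) *: U.
  by rewrite -(map_incidence _ (rho w)) -map_mxM u_eigen map_mxZ.
have -> : \sum_i rho w (u i 0) * cemb (Kinf w) (v 0 i) = (V *m U) 0 0.
  by rewrite mxE; apply: eq_bigr => i _; rewrite !mxE mulrC.
rewrite (eigenvectors_mulmx0 VM MU) ?mxE//; apply/eqP => aE.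
have := infinite_contract w; rewrite -(cabs_cemb (Kinf w)) aE rho_isometric.
by rewrite ltNge (le_trans (ltW alpha_gt1)) ?ler_norm.
Qed.

(** The projection changes the vector by a multiple of [u], which the infinite coordinates of [G]
    kill. *)
Lemma Gmap_pi_u_ext x : G (pi_u_ext iota v u (Psi x)) = Phi (pairQ v x).
Proof.
rewrite /Gmap/Phi; congr pair; apply: functional_extensionality_dep => w /=.
rewrite /pairQ rmorph_sum.
transitivity (\sum_i (cemb (Kinf w) (x i 0 *: v 0 i) -
   rho w (pairR iota v (map_mx ratr x)) * (rho w (u i 0) * cemb (Kinf w) (v 0 i)))).
  apply: eq_bigr => i _; rewrite !mxE rmorphB mulrBl -rmorph_scale_rat.
  by rewrite (rmorphM (rho w) (pairR _ _ _)) mulrA.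
by rewrite big_split /= sumrN -mulr_sumr eigenvectors_orthogonal mulr0 subr0.
Qed.

Lemma Gmap_unif_continuous : unif_continuous (G : Rext n Kfin -> Ksigma Kinf Kfin).
Proof.
apply: (@pair_entourage_sub _ _
  (fmap (fun xy : Rext n Kfin * Rext n Kfin => (G xy.1, G xy.2)) entourage)) => E;
  last exact: snd_entourage.
move: E; apply: (@prod_topology_entourage_sub _ _
  (fmap (fun xy : Rext n Kfin * Rext n Kfin => ((G xy.1).1, (G xy.2).1))
    entourage)) => w E.
move=> /completion_entourageP[e e0 eE].
(* The added 1 makes [M] positive and larger than the sum, so the final bound by [e] is strict. *)
pose M := \sum_i sval w (v 0 i) + 1.
have w0 y : 0 <= sval w y by rewrite -(cabs_cemb (Kinf w)) cabs_ge0.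
have M0 : 0 < M by rewrite ltr_wpDl// sumr_ge0.
have := @fst_mx_entourage R n (prod_topology (fun w => Kfin w : uniformType))
  _ (divr_gt0 e0 M0).
apply: filterS => -[x y] /= xy; apply: eE => /=; rewrite -sumrB.
apply: le_lt_trans (cabs_sum _ _) _.
have : e / M * \sum_i sval w (v 0 i) < e.
  by rewrite -mulrA gtr_pMr// ltr_pdivrMl// mulr1 ltrDl.
apply: le_lt_trans; rewrite mulr_sumr; apply: ler_sum => i _.
rewrite -mulrBl cabsM cabs_cemb -rmorphB rho_isometric.
by rewrite ler_wpM2r// ltW.
Qed.

(** [E1star] ignores points outside Psi(Z), so membership must persist. The Parikh vector is written
    as M^-k (M^k P(p)) to share the power of M with [x]. *)
Lemma Zmodule_step x p : Zmodule sigma x ->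
  Zmodule sigma (invmx (incidence sigma rat) *m (x + parikh rat p)).
Proof.
move=> [k [y ->]]; set M := incidence sigma rat.
exists k.+1, (y + incidence sigma int ^+ k *m parikh int p).
rewrite map_mxD map_mxM rmorphXn /= (map_incidence _ (intr : {rmorphism int -> rat})).
have -> : map_mx intr (parikh int p) = parikh rat p :> 'cV_n.
  by apply/matrixP => i j; rewrite !mxE rmorph_nat.
rewrite !mulmxDr exprS -/M -[invmx M * _]/(invmx M *m _).
by rewrite -!mulmxA (mulmxA (_ ^+ k) (M ^+ k)) mulVmx_exp// mul1mx.
Qed.

Lemma Mext_inv_step x p : Mext_inv sigma (Qadd (Psi x) (Psi (parikh rat p))) =
  Psi (invmx (incidence sigma rat) *m (x + parikh rat p)).
Proof.
have a0 : alpha != 0 by apply: contraTneq alpha_gt1 => ->; rewrite rmorph0 ltr10.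
rewrite /Mext_inv/Qadd/Defs.Psi; congr pair; apply: functional_extensionality_dep => w /=.
rewrite -rmorphD -fmorphV -rmorphM -pairQD; congr (cemb (Kfin w) _).
by apply: (mulfI a0); rewrite mulVKf// -(pairQ_incidence v_eigen) mulKVmx.
Qed.

(** After rescaling, one step of [E1star] adds a digit at level [k], just as a new top edge does for
    a walk of length [k]. *)
Lemma pairQ_step k x p :
  alpha ^+ k.+1 * pairQ v (invmx (incidence sigma rat) *m (x + parikh rat p)) =
  alpha ^+ k * pairQ v x + alpha ^+ k * delta v p.
Proof.
rewrite exprSr -mulrA -(pairQ_incidence v_eigen) mulKVmx//.
by rewrite pairQD mulrDr.
Qed.

Lemma E1star_walk k a z b :
  iter k (E1star sigma v (Kfin := Kfin)) [set (Psi 0, a)] (z, b) ->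
  exists x, [/\ z = Psi x, Zmodule sigma x & walks k b a (alpha ^+ k * pairQ v x)].
Proof.
elim: k z b => [|k IH] z b /=.
  move=> [-> ->]; exists 0; split=> //.
    by exists 0%N, 0; rewrite map_mx0 mulmx0.
  have -> : pairQ v 0 = 0 by rewrite pairQE map_mx0 mulmx0 mxE.
  by rewrite mulr0; exact: walk_sums0.
move=> [z' [c [/IH[x [-> Zx wx]] _ [d [p [dc [-> ->]]]]]]].
exists (invmx (incidence sigma rat) *m (x + parikh rat p)); split.
- exact: Mext_inv_step.
- exact: Zmodule_step.
- by rewrite pairQ_step -addn1; apply: (walk_sums_cat wx); exact: walk_sums_edge.
Qed.

(** Converse of [E1star_walk]; membership in [Zmodule] is carried along because the next application
    of [E1star] requires it. *)
Lemma walk_E1star k a b y : walks k b a y -> exists x,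
  [/\ iter k (E1star sigma v (Kfin := Kfin)) [set (Psi 0, a)] (Psi x, b),
     Zmodule sigma x & y = alpha ^+ k * pairQ v x].
Proof.
elim: k b y => [|k IH] b y /=.
  move=> /walk_sums0E[-> ->]; exists 0; split=> //.
    by exists 0%N, 0; rewrite map_mx0 mulmx0.
  have -> : pairQ v 0 = 0 by rewrite pairQE map_mx0 mulmx0 mxE.
  by rewrite mulr0.
move=> /walk_sumsS[c [p [z [bc /IH[x [itx Zx ->]] ->]]]].
exists (invmx (incidence sigma rat) *m (x + parikh rat p)); split.
- exists (Psi x), c; split; [exact: itx|by exists x|exists b, p].
  by rewrite Mext_inv_step.
- exact: Zmodule_step.
- by rewrite pairQ_step.
Qed.

Lemma Mext_Psi k x : iter k (@Mext _ _ sigma _ _ Kfin) (Psi x) =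
  Psi (incidence sigma rat ^+ k *m x).
Proof.
elim: k => [|k IH] /=; first by rewrite mul1mx.
rewrite IH /Mext/Defs.Psi exprS -mulmxA; congr pair.
apply: functional_extensionality_dep => w /=.
by rewrite (pairQ_incidence v_eigen) rmorphM.
Qed.

Lemma pairQ_incidenceX k x :
  pairQ v (incidence sigma rat ^+ k *m x) = alpha ^+ k * pairQ v x.
Proof.
elim: k => [|k IH]; first by rewrite mul1mx mul1r.
by rewrite !exprS -mulmxA (pairQ_incidence v_eigen) IH mulrA.
Qed.

Lemma Gmap_E1_approx a k : G @` E1_approx sigma iota v u (Kfin := Kfin) a k =
  Phi @` [set x | exists b, walks k b a x].
Proof.
apply/seteqP; split=> [_ [_ [z [b [/E1star_walk[x [-> _ wx]] ->]]] <-]|].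
  exists (alpha ^+ k * pairQ v x); first by exists b.
  by rewrite Mext_Psi Gmap_pi_u_ext pairQ_incidenceX.
move=> _ [y [b /walk_E1star[x [itx _ ->]]] <-].
exists (pi_u_ext iota v u (iter k (@Mext _ _ sigma _ _ Kfin) (Psi x))).
  by exists (Psi x), b.
by rewrite Mext_Psi Gmap_pi_u_ext pairQ_incidenceX.
Qed.

End E1Subtile.

Theorem theorem7p7 (R : realType)
    (n : nat) (sigma : 'I_n -> seq 'I_n)
    (K : fieldExtType rat) (iota : {rmorphism K -> R}) (alpha : K)
    (v : 'rV[K]_n) (u : 'cV[R]_n)
    (Kinf : forall w : other_infinite_place iota, completion (sval w))
    (Kfin : forall w : finite_place_dividing R alpha, completion (sval w))
    (rho : forall w : other_infinite_place iota, {rmorphism R -> Kinf w})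
    (a : 'I_n) (Z : set R)
    (Omega : 'I_n -> set (Ksigma Kinf Kfin)) (T : set (Rext n Kfin)) :
  is_substitution sigma ->
  is_irreducible_pisot sigma (iota alpha) ->
  <<1; alpha>>%VS = {: K}%VS ->
  v *m incidence sigma K = alpha *: v ->
  (forall i, 0 < iota (v 0 i)) ->
  incidence sigma R *m u = iota alpha *: u ->
  pairR iota v u = 1 ->
  (forall w t, cabs (rho w t) = `|t|) ->
  is_kuratowski_lim (DT_integers sigma iota alpha v a) Z ->
  is_dual_prototile sigma v Omega ->
  is_E1_subtile sigma iota v u a T ->
  DT_subtile Kinf Kfin Z = Omega a /\ Omega a = Gmap v rho @` T.
Proof.
move=> [sigma_nonempty _] pisot gen v_eigen v_gt0 u_eigen _ rho_iso.
move=> [liminfZ limsupZ] OmegaP [_ [_ cT Tlim]].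
have [prim irr _ [_ alpha_gt1 _]] := pisot.
have v_neq0 : v != 0.
  apply/eqP => v0; have := v_gt0 a; rewrite v0 mxE rmorph0; by rewrite ltxx.
have contract w := other_infinite_place_lt1 v_eigen v_neq0 w pisot gen.
have alpha_neq0 : alpha != 0.
  by apply: contraTneq alpha_gt1 => ->; rewrite rmorph0 ltr10.
have unitM := incidence_unit iota v_eigen v_neq0 irr alpha_neq0.
(* The letter [b0] ends walks of sum 0 of every length, and leads to each [b] in the same number [m]
   of steps, with sum [t b]. *)
have [b0 b0P] := recurrent_letter alpha v sigma_nonempty a.
have [m mP] := primitive_walk alpha v prim.
have [t tP] := choice (fun b => mP b0 b).
split.
- apply/seteqP; split.
  (* [Omega a] is closed, so it suffices to place Phi(Z) in it. *)
  + have /closure_id -> := Omega_closed OmegaP (a := a).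
    apply: closure_subset => _ [x /= xZ <-].
    apply: (Omega_limsup contract OmegaP) => U yU N.
    have := xZ; rewrite -limsupZ => /(DT_limsup alpha_gt1 v_gt0)/(_ N)[k Nk].
    rewrite DT_integersE => -[x' [b wx'] /fmorph_inj xE].
    by exists k => //; exists b, x; split; [rewrite -xE|exact: nbhs_singleton].
  + move=> y ay U yU.
    have [N _ /(_ N (leqnn N))[x wx Ux]] := Omega_approx contract OmegaP tP ay yU.
    exists (Phi Kinf Kfin x); split=> //; exists x => //=.
    (* The approximating walk starts at [b0], so walks of sum 0 prolong it to every length from
       [N + m] on, without changing [x]. *)
    rewrite -liminfZ; apply: (@DT_liminf _ _ _ _ _ _ _ _ _ (N + m)) => k Nk.
    rewrite DT_integersE; exists x => //.
    have [b wb] := b0P (k - (N + m))%N; exists b.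
    by have := walk_sums_cat wx wb; rewrite mulr0 addr0 subnKC.
have GE := @Gmap_E1_approx R n sigma K iota alpha v u Kinf Kfin rho contract
  alpha_gt1 v_eigen u_eigen rho_iso unitM a.
have Gunif := @Gmap_unif_continuous R n K iota alpha v Kinf Kfin rho rho_iso.
apply/seteqP; split=> [y ay|_ [z Tz <-]].
(* G(T) is closed, so [y] need only be approximated: first by some [Phi x], which is a G-image of an
   approximating point, then by a point of G(T). *)
- have GT_closed : closed (Gmap v rho @` T).
    apply: compact_closed; first exact: Ksigma_hausdorff.
    apply: continuous_compact cT; apply: continuous_subspaceT.
    exact: unif_continuous_continuous.
  apply: GT_closed => U; rewrite -nbhs_entourageE => -[E entE EU].
  have yE : nbhs y (xsection (split_ent E) y).
    by rewrite -nbhs_entourageE; exists (split_ent E).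
  have [N1 _ h1] := Tlim _ (Gunif _ (entourage_split_ent entE)).
  have [N2 _ h2] := Omega_approx contract OmegaP tP ay yE.
  (* [N1 + N2] is late enough for both approximations; the walk obtained is [m] steps longer. *)
  have [x wx /xsectionP yx] := h2 (N1 + N2)%N (leq_addl _ _).
  have N1k : (N1 <= N1 + N2 + m)%N by rewrite -addnA leq_addr.
  have [z Az GzE] : (Gmap v rho @` E1_approx sigma iota v u a (N1 + N2 + m)%N)
      (Phi Kinf Kfin x).
    by rewrite GE; exists x => //; exists b0.
  have [z' Tz' zz'] := (h1 _ N1k).1 z Az.
  exists (Gmap v rho z'); split; first by exists z'.
  apply: EU; apply/xsectionP; apply: (entourage_split _ entE yx).
  by rewrite -GzE.
- apply: (Omega_limsup contract OmegaP) => U.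
  rewrite -nbhs_entourageE => -[E entE EU] N.
  (* Hausdorff convergence lists the approximating point first, the neighbourhood of G(z) lists it
     second; hence the inverse entourage. *)
  have [N1 _ h1] := Tlim _ (Gunif _ (entourage_inv entE)).
  have [z' Az' zz'] := (h1 (N + N1)%N (leq_addl _ _)).2 z Tz.
  have : (Gmap v rho @` E1_approx sigma iota v u a (N + N1)%N) (Gmap v rho z').
    by exists z'.
  rewrite GE => -[x [b wx] xE].
  exists (N + N1)%N; first exact: leq_addr.
  exists b, x; split=> //; apply: EU; apply/xsectionP; rewrite xE.
  exact: zz'.
Qed.
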